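(* If $P$ is a grid polygon, then $$\operatorname{area}(P)\geq 6\operatorname{cyc}(P)-6.$$
   Context: Consider the infinite triangular grid in the plane, scaled so that each equilateral triangular grid cell has side length $1$ and oriented so that some of the grid lines are horizontal. The sides of the grid cells are called panes. A grid polygon is a (not necessarily convex) polygon (the closed region, including its boundary) whose boundary is a union of panes; the boundary, viewed as a closed curve, does not intersect itself. Let $P$ be a grid polygon with boundary panes $b_1,\ldots,b_n$, listed clockwise. From the midpoint of a boundary pane $b_i$, emit a beam of light into the interior of $P$ so that the beam forms a $60^\circ$ angle with $b_i$ and travels either northeast (direction $60^\circ$), southeast (direction $-60^\circ$), or west (direction $180^\circ$), depending on the orientation of $b_i$ (exactly one of these three directions satisfies the requirements). The beam travels in a straight line through the interior of $P$ until reaching the midpoint of a different boundary pane $b_{\pi(i)}$, which it meets at a $60^\circ$ angle. This defines a permutation $\pi=\pi_P\colon[n]\to[n]$, where $[n]=\{1,\ldots,n\}$, called the billiards permutation of $P$. $\operatorname{area}(P)$ denotes the number of triangular grid cells in $P$ (the Euclidean area multiplied by $4/\sqrt3$). $\operatorname{cyc}(P)$ denotes the number of cycles of $\pi_P$. *)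

(* Defs.v *)
From mathcomp Require Import all_boot all_order all_algebra all_fingroup.
From mathcomp Require Import finmap zify.
From mathcomp Require Import boolp.

Set Implicit Arguments.
Unset Strict Implicit.
Unset Printing Implicit Defensive.

Import GRing.Theory Num.Theory.

Local Open Scope fset_scope.
Local Open Scope ring_scope.

(* A vertex (a, b) of the triangular grid stands for the point
   a (1, 0) + b (1/2, sqrt 3 / 2) of the plane. *)
Definition vertex : Type := (int * int)%type.

(* The unit vectors in the directions 0, 60, 120, 180, 240 and 300 degrees. *)
Definition unit_vectors : seq vertex :=
  [:: (1, 0); (0, 1); (-1, 1); (-1, 0); (0, -1); (1, -1)].

(* Rotation of the plane by -60 degrees. *)
Definition rot_cw (d : vertex) : vertex := (d.1 + d.2, - d.1).

(* (v, true) is the upward pointing triangle whose lower left corner is v;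
   (v, false) is the downward pointing triangle that shares with it the pane
   between v + (1, 0) and v + (0, 1). *)
Definition cell : Type := (vertex * bool)%type.

Definition corners (c : cell) : seq vertex :=
  let: (v, up) := c in
  if up then [:: v; v + (1, 0); v + (0, 1)]
  else [:: v + (1, 0); v + (0, 1); v + (1, 1)].

(* A pane with endpoints u and w is represented by u + w, that is, by twice its
   midpoint (a pane is determined by its midpoint). *)
Definition pane : Type := (int * int)%type.

Definition sides (c : cell) : seq pane :=
  let t := corners c in [:: t`_0 + t`_1; t`_1 + t`_2; t`_2 + t`_0].

(* The panes forming the topological boundary of the union of the (closed)
   cells in S. *)
Definition boundary_pane (S : {fset cell}) (p : pane) : bool :=
  #|` [fset c in S | p \in sides c]| == 1%N.

(* A grid polygon: a finite union of cells whose boundary is a closed curve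
   bvertex 0, bvertex 1, ..., bvertex (perim - 1), bvertex 0 that traverses
   panes and does not intersect itself. The curve is traversed clockwise, i.e.,
   with the polygon on its right. Connectedness of the interior and absence of
   holes follow from the boundary being a single simple closed curve. *)
Record grid_polygon := GridPolygon {
  pcells : {fset cell};
  perim : nat;
  bvertex : 'I_perim -> vertex;
  perim_gt2 : (2 < perim)%N;
  bvertex_inj : injective bvertex;
  bvertex_adj : forall i, bvertex (ordS i) - bvertex i \in unit_vectors;
  boundaryP : forall p, boundary_pane pcells p <->
    exists i, p = bvertex i + bvertex (ordS i);
  clockwise : forall i,
    let u := bvertex i in let w := bvertex (ordS i) in
    exists2 c, c \in pcells & {subset [:: u; w; u + rot_cw (w - u)] <= corners c}
}.

Definition bpane (P : grid_polygon) (i : 'I_(perim P)) : pane :=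
  bvertex i + bvertex (ordS i).

(* Northeast, southeast and west. *)
Definition beam_dirs : seq vertex := [:: (0, 1); (1, -1); (-1, 0)].

(* As panes are given by their doubled midpoints, adding the unit vector d to a
   pane translates its midpoint by d / 2. So [crosses S p d] says that light
   emitted from the midpoint of p in direction d traverses a cell of S and
   leaves it at the midpoint of the side p + d. The segment between the
   midpoints of two sides of an equilateral triangle is parallel to the third
   side, hence forms 60 degree angles with both. *)
Definition crosses (S : {fset cell}) (p : pane) (d : vertex) : Prop :=
  exists2 c, c \in S & (p \in sides c) && (p + d \in sides c).

Definition beam (P : grid_polygon) (p q : pane) : Prop :=
  exists2 d, d \in beam_dirs & exists k : nat,
    [/\ (0 < k)%N,
        forall j, (j < k)%N -> crosses (pcells P) (p + d *+ j) d,
        forall j, (0 < j < k)%N -> ~~ boundary_pane (pcells P) (p + d *+ j),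
        q = p + d *+ k & boundary_pane (pcells P) q].

Definition is_billiards_perm (P : grid_polygon) (s : {perm 'I_(perim P)}) :=
  forall i, beam P (bpane i) (bpane (s i)).

Lemma pairD (a b c d : int) : (a, b) + (c, d) = (a + c, b + d) :> vertex.
Proof. by []. Qed.

Lemma pairN (a b : int) : - (a, b) = (- a, - b) :> vertex.
Proof. by []. Qed.

Lemma pairMn (a b : int) k :
  (a, b) *+ k = (a * k%:Z, b * k%:Z) :> vertex.
Proof.
elim: k => [|k IH]; first by rewrite mulr0n !mulr0.
by rewrite mulrSr IH pairD; congr pair; lia.
Qed.

Lemma mem_sides (a b x y : int) (up : bool) :
  ((a, b) \in sides ((x, y), up)) =
  if up then [|| (a == x + x + 1) && (b == y + y),
                 (a == x + x + 1) && (b == y + y + 1)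
               | (a == x + x) && (b == y + y + 1)]
  else [|| (a == x + x + 1) && (b == y + y + 1),
           (a == x + x + 1) && (b == y + y + 2)
         | (a == x + x + 2) && (b == y + y + 1)].
Proof.
by case: up; rewrite /sides /corners /= !inE !pairD !xpair_eqE; lia.
Qed.

Lemma beam_dirsP (d : vertex) : d \in beam_dirs ->
  [\/ d = (0, 1), d = (1, -1) | d = (-1, 0)].
Proof.
by rewrite !inE => /or3P[]/eqP->; [constructor 1|constructor 2|constructor 3].
Qed.

Lemma beam_dir_exists p c : p \in sides c ->
  exists2 d, d \in beam_dirs & p + d \in sides c.
Proof.
case: p c => a b [[x y] up]; rewrite mem_sides => h.
have : [|| (a, b) + (0, 1) \in sides (x, y, up),
           (a, b) + (1, -1) \in sides (x, y, up)
         | (a, b) + (-1, 0) \in sides (x, y, up)].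
  by rewrite !pairD !mem_sides; case: up h; lia.
by case/or3P; [exists (0, 1)|exists (1, -1)|exists (-1, 0)].
Qed.

Lemma beam_dir_out p c d d' : d \in beam_dirs -> d' \in beam_dirs ->
  p \in sides c -> p + d \in sides c -> p + d' \in sides c -> d = d'.
Proof.
case: p c => a b [[x y] up] /beam_dirsP[]-> /beam_dirsP[]-> //;
  by rewrite !pairD !mem_sides; case: up; lia.
Qed.

Lemma beam_dir_in q c d d' : d \in beam_dirs -> d' \in beam_dirs ->
  q \in sides c -> q - d \in sides c -> q - d' \in sides c -> d = d'.
Proof.
case: q c => a b [[x y] up] /beam_dirsP[]-> /beam_dirsP[]-> //;
  by rewrite !pairN !pairD !mem_sides; case: up; lia.
Qed.

Lemma beam_no_return q c d : d \in beam_dirs ->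
  q \in sides c -> q + d \in sides c -> q - d \notin sides c.
Proof.
case: q c => a b [[x y] up] /beam_dirsP[]->;
  by rewrite !pairN !pairD !mem_sides; case: up; lia.
Qed.

Lemma beam_pass q c c' d : d \in beam_dirs -> q \in sides c ->
  q - d \in sides c -> q \in sides c' -> c' != c -> q + d \in sides c'.
Proof.
case: q c c' => a b [[x y] up] [[x' y'] up'] /beam_dirsP[]->;
  rewrite !pairN !pairD !mem_sides !xpair_eqE; case: up; case: up'; lia.
Qed.

Lemma mem_side_cells (S : {fset cell}) p c :
  (c \in [fset c in S | p \in sides c]) = (c \in S) && (p \in sides c).
Proof. by rewrite !inE. Qed.

Lemma boundary_paneP S p : boundary_pane S p ->
  exists c, [/\ c \in S, p \in sides c &
    forall c', c' \in S -> p \in sides c' -> c' = c].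
Proof.
case/cardfs1P=> c /fsetP Sc; exists c.
have := Sc c; rewrite mem_side_cells fset11 => /andP[cS pc]; split=> // c' c'S pc'.
by have := Sc c'; rewrite mem_side_cells c'S pc' in_fset1 => /esym/eqP.
Qed.

Lemma beam_leaves S p d : d \in beam_dirs ->
  exists k, ~ crosses S (p + d *+ k) d.
Proof.
move=> dD; apply: contrapT => /forallNP H.
pose T := flatten [seq sides c | c <- S].
pose s := [seq p + d *+ k | k <- iota 0 (size T).+1].
suff us : uniq s.
  have /(uniq_leq_size us) : {subset s <= T}.
    move=> _ /mapP[k _ ->]; have /contrapT[c cS /andP[pc _]] := H k.
    by apply/flattenP; exists (sides c) => //; apply/mapP; exists c.
  by rewrite size_map size_iota ltnn.
rewrite map_inj_uniq ?iota_uniq // => i j /addrI.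
by case/beam_dirsP: dD => ->; rewrite !pairMn => -[]; lia.
Qed.

Lemma beam_exists (P : grid_polygon) p : boundary_pane (pcells P) p ->
  exists q, beam P p q.
Proof.
move=> /boundary_paneP[c [cS pc _]].
have [d dD pdc] := beam_dir_exists pc.
have exk : exists k, ~~ `[< crosses (pcells P) (p + d *+ k) d >].
  by have [k /asboolPn] := @beam_leaves (pcells P) p d dD; exists k.
have [k /asboolPn kN kmin] := ex_minnP exk.
have cr j : (j < k)%N -> crosses (pcells P) (p + d *+ j) d.
  by move=> jk; apply: contrapT => /asboolPn /kmin; rewrite leqNgt jk.
have k0 : (0 < k)%N.
  by case: k kN {kmin cr} => // -[]; rewrite mulr0n addr0; exists c => //; apply/andP.
exists (p + d *+ k), d => //; exists k; split=> //.
- move=> j /andP[j0 jk]; apply/negP => /boundary_paneP[c1 [_ _ c1u]].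
  have [a aS /andP[ja ja']] := cr _ jk.
  have [b bS /andP[jb jb']] := cr j.-1 (leq_ltn_trans (leq_pred _) jk).
  have jE : p + d *+ j = p + d *+ j.-1 + d by rewrite -addrA -mulrSr prednK.
  have ab : a = b by rewrite (c1u _ aS ja) (c1u b) // jE.
  move: ja ja' jb; rewrite -ab => ja ja' jb.
  by have := beam_no_return dD ja ja'; rewrite jE addrK jb.
- have [b bS /andP[jb jb']] := cr k.-1 ltac:(by rewrite prednK).
  have kE : p + d *+ k = p + d *+ k.-1 + d by rewrite -addrA -mulrSr prednK.
  apply/cardfs1P; exists b; apply/fsetP => b'; rewrite mem_side_cells in_fset1.
  apply/andP/eqP => [[b'S kb']|->]; last by rewrite kE.
  apply: contra_notP kN => /eqP b'b; exists b' => //; rewrite kb' /=.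
  by apply: (beam_pass (c := b)) => //; rewrite kE ?addrK.
Qed.

Lemma beam_functional (P : grid_polygon) p q q' :
  boundary_pane (pcells P) p -> beam P p q -> beam P p q' -> q = q'.
Proof.
move=> /boundary_paneP[c [_ pc cu]] [d dD [k [k0 cr nb qE qb]]].
move=> [d' d'D [k' [k'0 cr' nb' q'E q'b]]].
have cross0 e : crosses (pcells P) (p + e *+ 0) e -> p + e \in sides c.
  by rewrite mulr0n addr0 => -[a aS /andP[pa]]; rewrite (cu a).
have dd' : d = d'.
  by apply: (beam_dir_out dD d'D pc); apply: cross0; [apply: cr|apply: cr'].
case: _ / dd' in cr' nb' q'E d'D *.
case: (ltngtP k k') => [lt|lt|kk'].
- by have := nb' k; rewrite k0 lt -qE qb => /(_ isT).
- by have := nb k'; rewrite k'0 lt -q'E q'b => /(_ isT).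
- by rewrite qE q'E kk'.
Qed.

Lemma beam_injective (P : grid_polygon) p p' q :
  boundary_pane (pcells P) p -> boundary_pane (pcells P) p' ->
  beam P p q -> beam P p' q -> p = p'.
Proof.
move=> pb p'b [d dD [k [k0 cr nb qE qb]]] [d' d'D [k' [k'0 cr' nb' q'E _]]].
have [c [_ qc cu]] := boundary_paneP qb.
have last_cross e r l : (0 < l)%N -> q = r + e *+ l ->
    crosses (pcells P) (r + e *+ l.-1) e -> q - e \in sides c.
  move=> l0 E; have -> : q = r + e *+ l.-1 + e by rewrite -addrA -mulrSr prednK.
  move=> [a aS /andP[ra ra']]; rewrite addrK -(cu a) //.
  by rewrite E -[l in X in X \in _](prednK l0) mulrSr addrA.
have dd' : d = d'.
  apply: (beam_dir_in dD d'D qc).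
    by apply: (last_cross d p k) => //; apply: cr; rewrite prednK.
  by apply: (last_cross d' p' k') => //; apply: cr'; rewrite prednK.
case: _ / dd' in cr' nb' q'E d'D *.
have sub r r' l l' : (l < l')%N -> q = r + d *+ l -> q = r' + d *+ l' ->
    r = r' + d *+ (l' - l).
  move=> ll' E E'; apply: (addIr (d *+ l)).
  by rewrite -E -addrA -mulrnDr subnK // ltnW.
case: (ltngtP k k') => [lt|lt|kk'].
- have := nb' (k' - k)%N; rewrite -(sub p p' k k') // pb subn_gt0 lt.
  by rewrite ltn_subrL k0 k'0 => /(_ isT).
- have := nb (k - k')%N; rewrite -(sub p' p k' k) // p'b subn_gt0 lt.
  by rewrite ltn_subrL k0 k'0 => /(_ isT).
- by apply: (addIr (d *+ k)); rewrite -qE q'E kk'.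
Qed.

Lemma bpane_boundary (P : grid_polygon) (i : 'I_(perim P)) :
  boundary_pane (pcells P) (bpane i).
Proof. by apply/boundaryP; exists i. Qed.

Lemma unit_vectors_mid (u e w f : vertex) :
  e \in unit_vectors -> f \in unit_vectors -> u + (u + e) = w + (w + f) ->
  u = w \/ u = w + f /\ w = u + e.
Proof.
case: u w => a b [x y]; rewrite !inE.
by do 5?[case/orP]; move=> /eqP->; do 5?[case/orP]; move=> /eqP->;
  rewrite !pairD => -[h1 h2]; first [left; congr pair; lia
   | right; split; congr pair; lia | exfalso; lia].
Qed.

Lemma bpane_inj (P : grid_polygon) : injective (@bpane P).
Proof.
move=> i j; rewrite /bpane => E.
have := @unit_vectors_mid (bvertex i) _ (bvertex j) _ (bvertex_adj i) (bvertex_adj j).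
rewrite !subrKC => /(_ E)[/bvertex_inj //|[/bvertex_inj ij /bvertex_inj ji]].
have := congr1 val ij; rewrite ji /= => {}E.
have key (x n : nat) : (2 < n)%N -> (x < n)%N ->
    x = ((x.+1 %% n).+1 %% n)%N -> False.
  move=> n3 xn; rewrite -addn1 modnDml; have [lt|ge] := ltnP (x + 2) n.
    by rewrite modn_small; lia.
  have -> : (x.+1 + 1 = n + (x + 2 - n))%N by lia.
  by rewrite modnDl modn_small; lia.
by case: (key _ _ (perim_gt2 P) (ltn_ord i) E).
Qed.

Lemma billiards_perm_exists (P : grid_polygon) :
  exists s : {perm 'I_(perim P)}, is_billiards_perm s.
Proof.
have H (i : 'I_(perim P)) : exists j : 'I_(perim P), beam P (bpane i) (bpane j).
  have [q bq] := beam_exists (bpane_boundary i).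
  have qb : boundary_pane (pcells P) q by case: bq => d _ [k []].
  by move/boundaryP: qb bq => [j ->]; exists j.
have [f fP] := choice H.
have f_inj : injective f.
  move=> i j ij; apply: bpane_inj; have := fP i; rewrite ij => bi.
  exact: (beam_injective (bpane_boundary i) (bpane_boundary j) bi (fP j)).
by exists (perm f_inj) => i; rewrite permE.
Qed.

Definition billiards_perm (P : grid_polygon) : {perm 'I_(perim P)} :=
  sval (cid (billiards_perm_exists P)).

Lemma billiards_permP (P : grid_polygon) : is_billiards_perm (billiards_perm P).
Proof. exact: svalP (cid (billiards_perm_exists P)). Qed.

Lemma billiards_perm_unique (P : grid_polygon) (s : {perm 'I_(perim P)}) :
  is_billiards_perm s -> s = billiards_perm P.
Proof.
move=> sP; apply/permP => i; apply: bpane_inj.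
exact: (beam_functional (bpane_boundary i) (sP i) (billiards_permP i)).
Qed.

Definition area (P : grid_polygon) : nat := #|` pcells P|.

Definition cyc (P : grid_polygon) : nat := #|porbits (billiards_perm P)|.

(* Main.v *)
Require Import Defs.
From mathcomp Require Import all_boot all_order all_algebra.
From mathcomp Require Import all_fingroup finmap zify.
From mathcomp Require Import boolp.

(* Colour the trajectories by elements of F_2. The winding number mod 2 of the
   coloured trajectories is a function g on the grid vertices. It vanishes on
   the boundary curve, its jump across a pane is the sum of the colours of the
   two beams crossing there, and so the sum of g over the six neighbours of an
   interior vertex telescopes to 0. If g vanishes at all interior vertices, then
   the colouring is constant; hence these g form a space of dimension cyc - 1.

   Fix a unit vector e and let R_e be the set of interior x such that x + e is
   not interior. If g vanishes on R_e, then g = 0: otherwise take x in the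
   support of g with the largest inner product with e; since x + e is interior,
   the sum of g over the neighbours of x + e is 0, but x is the only neighbour
   at which g can be nonzero. Thus cyc - 1 <= |R_e|. Finally, sending (x, e) to
   the cell on the left of the pane from x to x + e is injective on the disjoint
   union of the six sets R_e, so their sizes add up to at most the area. *)

Set Implicit Arguments.
Unset Strict Implicit.
Unset Printing Implicit Defensive.

Import Order.TTheory GRing.Theory Num.Theory.

Local Open Scope fset_scope.
Local Open Scope ring_scope.

(** * Colours of beams *)

Lemma beam_pass_back q c c' d : d \in beam_dirs -> q \in sides c ->
  q + d \in sides c -> q \in sides c' -> c' != c -> q - d \in sides c'.
Proof.
case: q c c' => a b [[x y] up] [[x' y'] up'] /beam_dirsP[]->;
  rewrite !pairN !pairD !mem_sides !xpair_eqE; case: up; case: up'; lia.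
Qed.

Lemma nonboundary_cell (S : {fset cell}) p c : c \in S -> p \in sides c ->
  ~~ boundary_pane S p -> exists c', [/\ c' \in S, p \in sides c' & c' != c].
Proof.
move=> cS pc; apply: contraNP => /forallNP H; apply/cardfs1P; exists c.
apply/fsetP => c'; rewrite mem_side_cells in_fset1.
apply/andP/eqP => [[c'S pc']|-> //]; apply: contra_notP (H c') => /eqP.
by split.
Qed.

Lemma crosses_next (S : {fset cell}) p d : d \in beam_dirs ->
  ~~ boundary_pane S (p + d) -> crosses S p d <-> crosses S (p + d) d.
Proof.
move=> dD nb; split=> -[c cS /andP[pc qc]].
- have [c' [c'S qc' c'c]] := nonboundary_cell cS qc nb; exists c' => //.
  by rewrite qc' (@beam_pass _ c) // addrK.
- have [c' [c'S qc' c'c]] := nonboundary_cell cS pc nb; exists c' => //.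
  by rewrite qc' andbT -[p](addrK d) (@beam_pass_back _ c).
Qed.

Section Colour.
Variable P : grid_polygon.
Local Notation S := (pcells P).

(** The last segment of a beam is included: [p] must come before the end of the beam, but the pane
    [p + d] may be a boundary pane. *)
Definition on_beam (p : pane) (d : vertex) (i : 'I_(perim P)) : Prop :=
  exists k : nat, [/\ p = bpane i + d *+ k,
    forall j, (j <= k)%N -> crosses S (bpane i + d *+ j) d &
    forall j, (0 < j <= k)%N -> ~~ boundary_pane S (bpane i + d *+ j)].

Lemma on_beam_crosses p d i : on_beam p d i -> crosses S p d.
Proof. by case=> k [-> cr _]; apply: cr. Qed.

(** If the two starting panes lay at different distances behind [p], the nearer one would be a
    boundary pane in the middle of the other beam. *)
Lemma on_beam_uniq p d i i' : on_beam p d i -> on_beam p d i' -> i = i'.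
Proof.
move=> [k [pE _ nb]] [k' [p'E _ nb']].
have sub r r' l l' : (l < l')%N -> p = r + d *+ l -> p = r' + d *+ l' ->
    r = r' + d *+ (l' - l).
  move=> ll' E E'; apply: (addIr (d *+ l)).
  by rewrite -E -addrA -mulrnDr subnK // ltnW.
case: (ltngtP k k') => [lt|lt|kk'].
- have := nb' (k' - k)%N; rewrite -(sub (bpane i) _ k) // bpane_boundary.
  by rewrite subn_gt0 lt leq_subr => /(_ isT).
- have := nb (k - k')%N; rewrite -(sub (bpane i') _ k') // bpane_boundary.
  by rewrite subn_gt0 lt leq_subr => /(_ isT).
- by apply: bpane_inj; apply: (addIr (d *+ k)); rewrite -pE p'E kk'.
Qed.

Lemma on_beam_next p d i : d \in beam_dirs ->
  ~~ boundary_pane S (p + d) -> on_beam p d i -> on_beam (p + d) d i.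
Proof.
move=> dD nb pi; have cr := (crosses_next dD nb).1 (on_beam_crosses pi).
have [k [pE crs nbs]] := pi.
have pdE : p + d = bpane i + d *+ k.+1 by rewrite pE mulrSr addrA.
exists k.+1; split=> // j.
- by rewrite leq_eqVlt ltnS => /orP[/eqP->|/crs //]; rewrite -pdE.
- case/andP=> j0; rewrite leq_eqVlt ltnS => /orP[/eqP->|jk]; first by rewrite -pdE.
  by apply: nbs; rewrite j0.
Qed.

Lemma on_beam_exists p d : d \in beam_dirs -> crosses S p d ->
  exists i, on_beam p d i.
Proof.
(* The backward ray meets distinct panes and [S] is finite, so it stops crossing cells; induction on
   [N] traces it back to the boundary pane where the beam starts. *)
move=> dD; have [N HN] : exists N, ~ crosses S (p - d *+ N) d.
  apply: contrapT => /forallNP H.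
  pose T := flatten [seq sides c | c <- S].
  pose s := [seq p - d *+ k | k <- iota 0 (size T).+1].
  suff us : uniq s.
    have /(uniq_leq_size us) : {subset s <= T}.
      move=> _ /mapP[k _ ->]; have /contrapT[c cS /andP[pc _]] := H k.
      by apply/flattenP; exists (sides c) => //; apply/mapP; exists c.
    by rewrite size_map size_iota ltnn.
  rewrite map_inj_uniq ?iota_uniq // => i j /addrI /oppr_inj.
  by case/beam_dirsP: dD => ->; rewrite !pairMn => -[]; lia.
elim: N p HN => [|N IH] p HN pd; first by rewrite mulr0n subr0 in HN.
have [/boundaryP[i pE]|nb] := boolP (boundary_pane S p).
  exists i, 0%N; split; first by rewrite mulr0n addr0.
  - by move=> j; rewrite leqn0 => /eqP->; rewrite mulr0n addr0 /bpane -pE.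
  - by case.
have nb' : ~~ boundary_pane S (p - d + d) by rewrite subrK.
have cr : crosses S (p - d) d by apply/(crosses_next dD nb'); rewrite subrK.
have [|i pi] := IH (p - d) _ cr; first by rewrite -addrA -opprD -mulrS.
by exists i; rewrite -[p](subrK d); apply: on_beam_next; rewrite ?subrK.
Qed.

Lemma on_beam_boundary p d i j : d \in beam_dirs -> on_beam p d i ->
  p + d = bpane j -> billiards_perm P i = j.
Proof.
move=> dD [k [pE cr nb]] pdE; apply: bpane_inj.
apply: (beam_functional (bpane_boundary i) (billiards_permP i)).
exists d => //; exists k.+1; split; rewrite ?bpane_boundary //.
by rewrite -pdE pE mulrSr addrA.
Qed.

(** Segments outside the polygon carry no light and get the value false, so that the local rules
    below hold on the whole grid. *)
Definition colour (chi : 'I_(perim P) -> bool) (p : pane) (d : vertex) : bool :=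
  `[< exists2 i, on_beam p d i & chi i >].

Lemma colourE chi p d i : on_beam p d i -> colour chi p d = chi i.
Proof.
move=> pi; apply/asboolP/idP => [[j pj]|]; last by exists i.
by rewrite (on_beam_uniq pi pj).
Qed.

Lemma colour_out chi p d : ~ crosses S p d -> colour chi p d = false.
Proof. by move=> n; apply/asboolP => -[i /on_beam_crosses]. Qed.

Lemma colour_add chi chi' p d : d \in beam_dirs ->
  colour (fun i => chi i (+) chi' i) p d = colour chi p d (+) colour chi' p d.
Proof.
move=> dD; have [/(on_beam_exists dD)[i pi]|n] := pselect (crosses S p d).
  by rewrite !(colourE _ pi).
by rewrite !colour_out.
Qed.

Lemma colour_start chi p d i : crosses S p d -> p = bpane i ->
  colour chi p d = chi i.
Proof.
move=> cr pE; apply: colourE; exists 0%N; split=> [|j|]; last by case.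
  by rewrite mulr0n addr0.
by rewrite leqn0 => /eqP->; rewrite mulr0n addr0 -pE.
Qed.

Lemma colour_next chi p d : d \in beam_dirs -> ~~ boundary_pane S p ->
  colour chi p d = colour chi (p - d) d.
Proof.
move=> dD nb; have nb' : ~~ boundary_pane S (p - d + d) by rewrite subrK.
have [cr|ncr] := pselect (crosses S (p - d) d).
  have [i pi] := on_beam_exists dD cr; rewrite (colourE _ pi).
  by apply: colourE; rewrite -[p](subrK d); apply: on_beam_next.
rewrite !colour_out // => cr; apply: ncr.
by apply/(crosses_next dD nb'); rewrite subrK.
Qed.

(* d and d' are the two beam directions not parallel to p; in each cell at p,
   light arrives at p in one of them and is reflected into the other. *)
Definition transverse (p d d' : vertex) : Prop := [/\ d \in beam_dirs,
  d' \in beam_dirs, d != d' & forall c, p \in sides c ->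
    (p + d \in sides c) && (p - d' \in sides c) ||
    (p + d' \in sides c) && (p - d \in sides c)].

Lemma transverse_sym p d d' : transverse p d d' -> transverse p d' d.
Proof. by move=> [? ? ? H]; split=> //; [rewrite eq_sym|move=> c /H; rewrite orbC]. Qed.

(** In one orientation the beam arriving in direction [d'] ends at [p], and the beam leaving in
    direction [d] is its successor under [billiards_perm]. In the other, both segments lie outside
    the polygon. *)
Lemma colour_reflect chi p d d' :
  (forall i, chi (billiards_perm P i) = chi i) ->
  transverse p d d' -> boundary_pane S p ->
  colour chi p d = colour chi (p - d') d'.
Proof.
move=> inv [dD d'D dd' tr] pb; have [c [cS pc cu]] := boundary_paneP pb.
case/orP: (tr c pc) => /andP[p1 p2].
  have cr : crosses S p d by exists c; rewrite // pc.
  have cr' : crosses S (p - d') d' by exists c; rewrite // p2 subrK.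
  have [i pE] : exists i : 'I_(perim P), p = bpane i by case/boundaryP: pb => i; exists i.
  have [j pj] := on_beam_exists d'D cr'.
  rewrite (colour_start _ cr pE) (colourE _ pj) -(inv j).
  by rewrite (on_beam_boundary d'D pj (j := i)) ?subrK.
rewrite !colour_out // => -[c' c'S /andP[]].
- rewrite subrK => q1 q2; rewrite (cu c') // in q1.
  by move/eqP: dd'; apply; apply: (beam_dir_in dD d'D pc).
- move=> q1 q2; rewrite (cu c') // in q2.
  by move/eqP: dd'; apply; apply: (beam_dir_out dD d'D pc).
Qed.

End Colour.

(** * The six cells around a vertex *)

Definition hexdir (k : nat) : vertex := nth 0 unit_vectors (k %% 6).

(* The corners of hexcell k x are x, x + hexdir k and x + hexdir (k + 1). All
   indices k around a vertex are read modulo 6. *)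
Definition hexcell (k : nat) (x : vertex) : cell :=
  nth (x, true) [:: (x, true); (x - (1, 0), false); (x - (1, 0), true);
    (x - (1, 1), false); (x - (0, 1), true); (x - (0, 1), false)] (k %% 6).

(* The initial point and the direction of the beam segment that cuts off the
   corner x of hexcell k x. *)
Definition corner_segment (k : nat) (x : vertex) : pane * vertex :=
  if odd k then (x + x + hexdir k, hexdir (k + 2))
  else (x + x + hexdir (k + 1), hexdir (k + 5)).

Ltac hexcases k := case: k => [|[|[|[|[|[|k]]]]]] //.

Lemma mem_unit_vectors d : d \in unit_vectors -> exists2 k, (k < 6)%N & d = hexdir k.
Proof.
by rewrite /hexdir; case/(nthP 0) => k k6 <-; exists k; rewrite ?modn_small.
Qed.

Lemma hexdir_unit k : hexdir k \in unit_vectors.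
Proof. by rewrite mem_nth // ltn_mod. Qed.

Lemma hexcell_shift k x : (k < 6)%N -> hexcell (k + 2) (x + hexdir k) = hexcell k x.
Proof.
by case: x => a b; hexcases k => _; rewrite /hexcell /hexdir /= ?pairN ?pairD;
  congr pair; congr pair; lia.
Qed.

Lemma hexcell_shift' k x : (k < 6)%N ->
  hexcell (k + 3) (x + hexdir k) = hexcell (k + 5) x.
Proof.
by case: x => a b; hexcases k => _; rewrite /hexcell /hexdir /= ?pairN ?pairD;
  congr pair; congr pair; lia.
Qed.

Lemma sides_pane k x c : (k < 6)%N ->
  (x + x + hexdir k \in sides c) = (c == hexcell k x) || (c == hexcell (k + 5) x).
Proof.
case: x c => a b [[u v] up]; hexcases k => _; rewrite /hexdir /hexcell /= ?pairN ?pairD;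
  by rewrite mem_sides !xpair_eqE; case: up; lia.
Qed.

Lemma hexcell_neq k x : (k < 6)%N -> hexcell k x != hexcell (k + 5) x.
Proof. by hexcases k => _; rewrite xpair_eqE /= andbF. Qed.

Lemma boundary_hexcell (S : {fset cell}) k x : (k < 6)%N ->
  boundary_pane S (x + x + hexdir k) =
  (hexcell k x \in S) (+) (hexcell (k + 5) x \in S).
Proof.
move=> k6; rewrite /boundary_pane.
have := sides_pane x _ k6; have := hexcell_neq x k6.
move: (hexcell k x) (hexcell (k + 5) x) => c c' cc' H.
have -> : [fset c0 in S | x + x + hexdir k \in sides c0] =
    [fset c0 in [fset c; c'] | c0 \in S].
  by apply/fsetP => c0; rewrite mem_side_cells H !inE andbC.
case: (boolP (c \in S)) => cS; case: (boolP (c' \in S)) => c'S.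
- have -> : [fset c0 in [fset c; c'] | c0 \in S] = [fset c; c'].
    by apply/fsetP => c0; rewrite !inE; case: eqP => [->|]; case: eqP => [->|].
  by rewrite cardfs2 cc'.
- have -> : [fset c0 in [fset c; c'] | c0 \in S] = [fset c].
    apply/fsetP => c0; rewrite !inE; case: eqP => [->|] //.
    by case: eqP => [->|]; rewrite ?(negbTE c'S).
  by rewrite cardfs1.
- have -> : [fset c0 in [fset c; c'] | c0 \in S] = [fset c'].
    apply/fsetP => c0; rewrite !inE; case: eqP => [->|] //.
      by rewrite (negbTE cS) (negbTE cc').
    by case: eqP => [->|]; rewrite ?c'S.
  by rewrite cardfs1.
- have -> : [fset c0 in [fset c; c'] | c0 \in S] = fset0.
    apply/fsetP => c0; rewrite !inE; case: eqP => [->|]; rewrite ?(negbTE cS) //.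
    by case: eqP => [->|]; rewrite ?(negbTE c'S).
  by rewrite cardfs0.
Qed.

(** The beam directions are [hexdir] of 1, 3 and 5. The one parallel to [hexdir k] has index k or k
    + 3 modulo 6; [pane_out] and [pane_out'] are the other two. *)
Definition pane_out k := hexdir (if odd k then k + 2 else k + 1).
Definition pane_out' k := hexdir (if odd k then k + 4 else k + 5).

Lemma transverse_pane k x : (k < 6)%N ->
  transverse (x + x + hexdir k) (pane_out k) (pane_out' k).
Proof.
case: x => a b; hexcases k => _; split=> // -[[u v] up];
  rewrite /hexdir /= ?pairN ?pairD ?mem_sides; case: up; lia.
Qed.

(** In each cell at the pane, one segment leaves [p] and one arrives there, cutting off different
    ends of the pane. Reflection pairs the two segments of a cell; straight passage pairs segments
    of different cells at opposite ends. *)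
Lemma corner_segment_pane k x : (k < 6)%N ->
  let p := x + x + hexdir k in let d := pane_out k in let d' := pane_out' k in
  let t := corner_segment k x in let t' := corner_segment (k + 5) x in
  let u := corner_segment (k + 2) (x + hexdir k) in
  let u' := corner_segment (k + 3) (x + hexdir k) in
  if odd k then [/\ t = (p, d), t' = (p, d'), u = (p - d', d') & u' = (p - d, d)]
  else [/\ u = (p, d), u' = (p, d'), t = (p - d', d') & t' = (p - d, d)].
Proof.
case: x => a b; hexcases k => _ /=; split;
  rewrite /corner_segment /pane_out /pane_out' /hexdir /= ?pairN ?pairD;
  by congr pair; congr pair => /=; lia.
Qed.

(** * Colours at the corners of cells *)

Section Potential.
Variable P : grid_polygon.
Local Notation S := (pcells P).
Local Notation colouring := ('I_(perim P) -> bool).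

Definition beam_invariant (chi : colouring) :=
  forall i, chi (billiards_perm P i) = chi i.

Definition corner_colour (chi : colouring) k x :=
  colour chi (corner_segment k x).1 (corner_segment k x).2.

Lemma corner_colour_boundary chi k x : beam_invariant chi -> (k < 6)%N ->
  boundary_pane S (x + x + hexdir k) ->
  corner_colour chi k x = corner_colour chi (k + 2) (x + hexdir k) /\
  corner_colour chi (k + 5) x = corner_colour chi (k + 3) (x + hexdir k).
Proof.
move=> inv k6 pb; have tr := transverse_pane x k6; have tr' := transverse_sym tr.
have [E E'] := (colour_reflect inv tr pb, colour_reflect inv tr' pb).
have := corner_segment_pane x k6; rewrite /corner_colour /=.
by case: odd => -[-> -> -> ->] /=; rewrite E E'.
Qed.

Lemma corner_colour_interior (chi : colouring) k x : (k < 6)%N ->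
  ~~ boundary_pane S (x + x + hexdir k) ->
  corner_colour chi (k + 2) (x + hexdir k) = corner_colour chi (k + 5) x /\
  corner_colour chi (k + 3) (x + hexdir k) = corner_colour chi k x.
Proof.
move=> k6 nb; have [dD d'D _ _] := transverse_pane x k6.
have [E E'] := (colour_next chi dD nb, colour_next chi d'D nb).
have := corner_segment_pane x k6; rewrite /corner_colour /=.
by case: odd => -[-> -> -> ->] /=; rewrite E E'.
Qed.

(** At a boundary pane both sides vanish by reflection; at any other pane the beams go straight on
    and the two summands change places. Hence the jump across a pane can be read in either cell. *)
Lemma corner_colour_two_sides chi k x : beam_invariant chi -> (k < 6)%N ->
  corner_colour chi k x (+) corner_colour chi (k + 2) (x + hexdir k) =
  corner_colour chi (k + 5) x (+) corner_colour chi (k + 3) (x + hexdir k).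
Proof.
move=> inv k6; have [b|nb] := boolP (boundary_pane S (x + x + hexdir k)).
  by have [-> ->] := corner_colour_boundary inv k6 b; rewrite !addbb.
by have [-> ->] := corner_colour_interior chi k6 nb; rewrite addbC.
Qed.

Lemma corner_segment_crosses k x : (k < 6)%N -> hexcell k x \in S ->
  crosses S (corner_segment k x).1 (corner_segment k x).2.
Proof.
move=> k6 cS; exists (hexcell k x) => //; case: x {cS} => a b; move: k6.
hexcases k => _; rewrite /corner_segment /hexcell /hexdir /= ?pairN ?pairD ?mem_sides;
  lia.
Qed.

End Potential.

(** * Winding numbers mod 2 *)

Ltac xor_atom a :=
  lazymatch a with true => fail | false => fail | addb _ _ => fail | _ => idtac end.

Ltac xor_cases :=
  repeat match goal with
    | |- context [addb ?a _] => xor_atom a; generalize a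
    | |- context [addb _ ?a] => xor_atom a; generalize a
    | |- context [@eq bool ?a _] => xor_atom a; generalize a
    | |- context [@eq bool _ ?a] => xor_atom a; generalize a
    end;
  repeat match goal with |- forall _ : bool, _ => case end; done.

Lemma hexcell_mod k x : hexcell (k %% 6) x = hexcell k x.
Proof. by rewrite /hexcell modn_mod. Qed.

Lemma hexdir_mod k : hexdir (k %% 6) = hexdir k.
Proof. by rewrite /hexdir modn_mod. Qed.

Lemma corner_segment_mod k x : corner_segment (k %% 6) x = corner_segment k x.
Proof. by rewrite /corner_segment /hexdir odd_mod // modn_mod !modnDml. Qed.

Lemma hexdir_inj k l : (k < 6)%N -> (l < 6)%N -> hexdir k = hexdir l -> k = l.
Proof. by hexcases k => _; hexcases l. Qed.

Lemma hexdir_opp k : - hexdir k = hexdir (k + 3).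
Proof.
rewrite -[in LHS]hexdir_mod /hexdir -(modnDml k 3) modn_mod.
by have := ltn_pmod k (isT : 0 < 6)%N; move: (k %% 6)%N => {}k; hexcases k.
Qed.

Lemma int_ind_step (Q : int -> Prop) :
  Q 0 -> (forall a, Q a <-> Q (a + 1)) -> forall a, Q a.
Proof.
move=> Q0 QS; elim/int_rect=> // n Qn.
- by have -> : n.+1%:Z = n%:Z + 1 by [lia]; apply: (QS _).1.
- by apply: (QS _).2; have -> : - n.+1%:Z + 1 = - n%:Z by lia.
Qed.

Lemma int_primitive (f : int -> bool) :
  exists F : int -> bool, forall n, F (n + 1) = F n (+) f n.
Proof.
exists (fun n => match n with
  | Posz m => \big[addb/false]_(0 <= i < m) f i
  | Negz m => \big[addb/false]_(0 <= i < m.+1) f (Negz i) end).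
case=> [n|[|n]].
- by rewrite -PoszD addn1 /= big_nat_recr.
- by rewrite /= big_nat1 big_geq // addbb.
- have -> : Negz n.+1 + 1 = Negz n by lia.
  by rewrite [in RHS]big_nat_recr //= -addbA addbb addbF.
Qed.

(** A closed discrete 1-form mod 2 on the square lattice is exact: [u] is integrated along the
    column a = 0, then [h] along each row. *)
Lemma grid_potential (h u : int -> int -> bool) :
  (forall a b, h a b (+) u (a + 1) b = u a b (+) h a (b + 1)) ->
  exists w : vertex -> bool, forall a b,
    w (a + 1, b) = w (a, b) (+) h a b /\ w (a, b + 1) = w (a, b) (+) u a b.
Proof.
move=> cl; have [H HE] := choice (fun b => int_primitive (h ^~ b)).
have [U UE] := int_primitive (u 0).
exists (fun x => U x.2 (+) H x.2 0 (+) H x.2 x.1) => a b; split=> /=.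
  by rewrite HE addbA.
have step c e (p q r s n r' : bool) : n (+) r' = r (+) s ->
    (c (+) p = e (+) q (+) r) <-> (c (+) (p (+) s) = e (+) (q (+) n) (+) r').
  by move: c e p q r s n r'; do 8![case].
(* The vertical relation holds on column 0 by the choice of [U], and closedness carries it to the
   adjacent columns. *)
rewrite UE; move: a; apply: int_ind_step => [|a].
  by rewrite !(addbC _ (H _ _)) !addbA !addbb.
by rewrite !HE; apply: step.
Qed.

Lemma ordS_const T n (f : 'I_n -> T) :
  (forall i, f (ordS i) = f i) -> forall i j, f i = f j.
Proof.
case: n f => [|n] f fS; first by case.
suff f0 i : f i = f ord0 by move=> i j; rewrite !f0.
case: i; elim=> [|m IH] lt; first by congr f; apply: val_inj.
rewrite -(IH (ltnW lt)) -[RHS]fS; congr f; apply: val_inj.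
by rewrite /= modn_small.
Qed.

Section Winding.
Variable P : grid_polygon.
Local Notation S := (pcells P).
Local Notation colouring := ('I_(perim P) -> bool).

(* g is the winding number mod 2 of the trajectories with colour true. Its jump
   across a pane is read off in the cell hexcell k x, in which the segments
   meeting the pane cut off the corners x and x + hexdir k. *)
Definition winding (chi : colouring) (g : vertex -> bool) :=
  (forall k x, (k < 6)%N -> g x (+) g (x + hexdir k) =
     corner_colour chi k x (+) corner_colour chi (k + 2) (x + hexdir k)) /\
  forall i, g (@bvertex P i) = false.

Lemma bvertex_next (i : 'I_(perim P)) : exists k, [/\ (k < 6)%N,
  bvertex (ordS i) = bvertex i + hexdir k & bpane i = bvertex i + bvertex i + hexdir k].
Proof.
have /mem_unit_vectors[k k6 E] := bvertex_adj i; exists k.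
by rewrite /bpane -addrA -E subrKC.
Qed.

(** Each corner segment meets two sides of its cell, so the jumps around a cell sum to 0 and are the
    differences of a potential. Boundary jumps are 0, so the potential is constant along the curve
    and can be shifted to vanish there. *)
Lemma winding_exists chi : beam_invariant chi -> exists g, winding chi g.
Proof.
move=> inv; have two k x k6 := @corner_colour_two_sides P chi k x inv k6.
pose cc (k : nat) := corner_colour chi k.
have t0 x : cc 0 x (+) cc 2 (x + hexdir 0) = cc 5 x (+) cc 3 (x + hexdir 0).
  exact: two.
have t1 x : cc 1 x (+) cc 3 (x + hexdir 1) = cc 0 x (+) cc 4 (x + hexdir 1).
  exact: two.
have t2 x : cc 2 x (+) cc 4 (x + hexdir 2) = cc 1 x (+) cc 5 (x + hexdir 2).
  exact: two.
have [a b|w wE] := @grid_potential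
    (fun a b => cc 0 (a, b) (+) cc 2 (a + 1, b))
    (fun a b => cc 1 (a, b) (+) cc 3 (a, b + 1)).
  have aux (c0 c1 c2 c3 d0 d1 d2 d3 p q : bool) : c2 (+) p = d1 (+) q ->
      c1 (+) c3 = c0 (+) p -> d0 (+) d2 = q (+) d3 ->
      c0 (+) c2 (+) (d1 (+) d3) = c1 (+) c3 (+) (d0 (+) d2).
    move=> E -> ->; move: E; move: c0 c2 d1 d3 p q.
    by do 6![case].
  have := t2 (a + 1, b); have := t1 (a, b); have := t0 (a, b + 1).
  rewrite /hexdir /= !pairD !addr0 addrK => E0 E1 E2; exact: aux E2 E1 E0.
have w0 x : w x (+) w (x + hexdir 0) = cc 0 x (+) cc 2 (x + hexdir 0).
  by case: x => a b; rewrite /hexdir /= pairD addr0 (wE a b).1 addbA addbb.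
have w1 x : w x (+) w (x + hexdir 1) = cc 1 x (+) cc 3 (x + hexdir 1).
  by case: x => a b; rewrite /hexdir /= pairD addr0 (wE a b).2 addbA addbb.
have aux (a b c d p q r s : bool) : p (+) q = r (+) s -> a (+) b = p (+) q ->
    a (+) c = r (+) d -> c (+) b = d (+) s by xor_cases.
have w2 x : w x (+) w (x + hexdir 2) = cc 2 x (+) cc 4 (x + hexdir 2).
  have := w0 (x + hexdir 3); have := w1 (x + hexdir 3).
  have := t1 (x + hexdir 3); rewrite -!addrA.
  rewrite -[hexdir 3 + hexdir 1]/(hexdir 2) -[hexdir 3 + hexdir 0]/(0 : vertex).
  rewrite addr0 => E1 E2 E3; exact: aux E1 E2 E3.
have wS k y : (k < 6)%N -> (forall x, w x (+) w (x + hexdir k) =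
      cc k x (+) cc (k + 2) (x + hexdir k)) ->
    w y (+) w (y + hexdir (k + 3)) = cc (k + 3) y (+) cc (k + 5) (y + hexdir (k + 3)).
  move=> k6 /(_ (y + hexdir (k + 3))); have := two k (y + hexdir (k + 3)) k6.
  by rewrite -/cc -hexdir_opp subrK => -> E; rewrite addbC E addbC.
have wk k x : (k < 6)%N ->
    w x (+) w (x + hexdir k) = cc k x (+) cc (k + 2) (x + hexdir k).
  by hexcases k => _; [exact: (wS 0%N)|exact: (wS 1%N)|exact: (wS 2%N)].
have bE i : w (bvertex (ordS i)) = w (@bvertex P i).
  have [k [k6 vE pE]] := bvertex_next i.
  have b : boundary_pane S (bvertex i + bvertex i + hexdir k).
    by rewrite -pE bpane_boundary.
  have := wk k (bvertex i) k6; rewrite /cc (corner_colour_boundary inv k6 b).1 addbb.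
  rewrite -vE; xor_cases.
pose i0 : 'I_(perim P) := Ordinal (ltnW (ltnW (perim_gt2 P))).
exists (fun x => w x (+) w (bvertex i0)).
split=> [k x k6|i].
  rewrite -wk //; xor_cases.
by rewrite (ordS_const bE i i0) addbb.
Qed.

Lemma winding_add chi chi' g g' : winding chi g -> winding chi' g' ->
  winding (fun i => chi i (+) chi' i) (fun x => g x (+) g' x).
Proof.
have cD k x : corner_colour (fun i => chi i (+) chi' i) k x =
    corner_colour chi k x (+) corner_colour chi' k x.
  apply: colour_add; rewrite -corner_segment_mod.
  have := ltn_pmod k (isT : 0 < 6)%N; move: (k %% 6)%N => {}k.
  by hexcases k.
move=> [w b] [w' b']; split=> [k x k6|i]; last by rewrite b b'.
by rewrite !cD addbACA w // w' // addbACA.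
Qed.

Definition interior (x : vertex) : bool :=
  all (fun k => hexcell k x \in S) (iota 0 6).

Lemma interiorP x : reflect (forall k, hexcell k x \in S) (interior x).
Proof.
apply: (iffP allP) => [H k|H k _ //].
by rewrite -hexcell_mod H // mem_iota ltn_mod.
Qed.

(** Around [x], membership in [S] changes only across boundary panes, and the ends of these lie on
    the curve. *)
Lemma interior_or_boundary k x :
  hexcell k x \in S -> interior x \/ exists i, x = @bvertex P i.
Proof.
move=> kS; have [[r r6 /boundaryP[i pE]]|nb] :=
    pselect (exists2 r, (r < 6)%N & boundary_pane S (x + x + hexdir r)).
  right; have [l [l6 vE _]] := bvertex_next i; rewrite vE -addrA in pE.
  have [->|[-> _]] := unit_vectors_mid (hexdir_unit r) (hexdir_unit l) pE.
    by exists i.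
  by exists (ordS i).
left; have E r : hexcell (r + 5) x \in S = (hexcell r x \in S).
  rewrite -(hexcell_mod r) -hexcell_mod -modnDml hexcell_mod.
  have r6 := ltn_pmod r (isT : 0 < 6)%N; apply/eqP.
  rewrite eq_sym -negb_add -boundary_hexcell //.
  by apply/negP => b; apply: nb; exists (r %% 6)%N.
have E' r : hexcell (k + 5 * r) x \in S.
  by elim: r => [|r IH]; rewrite ?muln0 ?addn0 // mulnSr addnA E.
apply/interiorP => r; rewrite -hexcell_mod.
(* Modulo 6 the product 5 * 5 is 1, so the right side is k + (5 * k + r), that is, r. *)
have -> : (r %% 6 = (k + 5 * (5 * (5 * k + r))) %% 6)%N by lia.
by rewrite hexcell_mod.
Qed.

Lemma winding_neighbour chi g k x : winding chi g -> (k < 6)%N ->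
  hexcell k x \in S -> interior (x + hexdir k) \/ g (x + hexdir k) = false.
Proof.
move=> [_ gb] k6; rewrite -hexcell_shift // => /interior_or_boundary[|[i ->]].
  by left.
by right.
Qed.

Lemma winding_inside chi g k x : winding chi g -> (k < 6)%N ->
  hexcell k x \in S -> hexcell (k + 5) x \in S -> g x (+) g (x + hexdir k) =
  corner_colour chi k x (+) corner_colour chi (k + 5) x.
Proof.
move=> [wE _] k6 kS k5S; rewrite wE //.
have nb : ~~ boundary_pane S (x + x + hexdir k) by rewrite boundary_hexcell // kS k5S.
by rewrite (corner_colour_interior chi k6 nb).1.
Qed.

Lemma winding_sum chi g y : winding chi g -> interior y ->
  \big[addb/false]_(k < 6) g (y + hexdir k) = false.
Proof.
move=> w /interiorP yI; have E k k6 := @winding_inside _ _ k y w k6 (yI _) (yI _).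
have swap a b c : g y (+) a = b (+) c -> a = g y (+) b (+) c by xor_cases.
have aux (z a b c d e f : bool) : z (+) a (+) f (+) (z (+) b (+) a (+)
    (z (+) c (+) b (+) (z (+) d (+) c (+) (z (+) e (+) d (+)
    (z (+) f (+) e))))) = false by xor_cases.
rewrite !big_ord_recl big_ord0 /= addbF.
by do 6![rewrite (swap _ _ _ (E _ _)) //].
Qed.

End Winding.

(** * Interior vertices next to the boundary *)

(* Minus twice the inner product with hexdir k. *)
Definition depth k (x : vertex) : int := let e := hexdir k in
  - (x.1 * e.1 *+ 2 + x.1 * e.2 + x.2 * e.1 + x.2 * e.2 *+ 2).

Lemma depth_lt k l y : (k < 6)%N -> (l < 6)%N -> (l != (k + 3) %% 6)%N ->
  depth k (y + hexdir l) < depth k (y + hexdir (k + 3)).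
Proof.
case: y => a b; hexcases k => _; hexcases l => _ _;
  rewrite /depth /hexdir /= ?pairD /=; lia.
Qed.

(* If exactly two panes k, l at a boundary vertex are boundary panes, the cells
   of the polygon at that vertex (those r with m r) form a single fan from k to
   l, so a colour t that agrees across the other panes agrees at both ends. *)
Lemma fan (m t : nat -> bool) k l : (k < 6)%N -> (l < 6)%N -> k != l ->
  (forall r, (r < 6)%N -> m r (+) m ((r + 5) %% 6)%N = (r == k) || (r == l)) ->
  (forall r, (r < 6)%N -> m r -> m ((r + 5) %% 6)%N -> t r = t ((r + 5) %% 6)%N) ->
  (if m k then t k else t ((k + 5) %% 6)%N) = (if m l then t l else t ((l + 5) %% 6)%N).
Proof.
have prev r : (r < 6)%N -> ((r + 5) %% 6)%N = if r is q.+1 then q else 5%N.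
  by hexcases r.
move=> k6 l6 kl H T; rewrite !prev //.
have := (H 1%N isT, H 2%N isT, H 3%N isT, H 4%N isT, H 5%N isT).
have := (T 0%N isT, T 1%N isT, T 2%N isT, T 3%N isT, T 4%N isT, T 5%N isT).
rewrite !prev // => -[[[[[T0 T1] T2] T3] T4] T5] [[[[H1 H2] H3] H4] H5].
move: H1 H2 H3 H4 H5 T0 T1 T2 T3 T4 T5 {H T prev}.
move: k6 l6 kl; hexcases k => _; hexcases l => _ // _ /=;
  case: (m 0%N); case: (m 1%N) => //; case: (m 2%N) => //; case: (m 3%N) => //;
  case: (m 4%N) => //; case: (m 5%N) => // _ _ _ _ _;
  intros; repeat match goal with H : is_true true -> _ |- _ => specialize (H isT) end;
  congruence.
Qed.

Section Area.
Variable P : grid_polygon.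
Local Notation S := (pcells P).
Local Notation colouring := ('I_(perim P) -> bool).

(** Every interior [x] is the base of the cell [(x, true)] in [S]; taking the image of [S] makes the
    set finite. *)
Definition interior_vertices : {fset vertex} :=
  [fset x in [fset c.1 | c in S] | interior P x].

Lemma mem_interior x : (x \in interior_vertices) = interior P x.
Proof.
rewrite !inE andb_idl // => /interiorP/(_ 0%N) xS.
by apply/imfsetP; exists (x, true).
Qed.

Definition rim k : {fset vertex} :=
  [fset x in interior_vertices | ~~ interior P (x + hexdir k)].

Lemma mem_rim k x :
  (x \in rim k) = interior P x && ~~ interior P (x + hexdir k).
Proof. by rewrite -(mem_interior x) !inE. Qed.

Lemma winding_rim (chi : colouring) g k : (k < 6)%N -> winding chi g ->
  {in rim k, forall x, g x = false} -> forall x, interior P x -> g x = false.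
Proof.
move=> k6 w g0 x0 x0I; apply: contraPF (erefl true) => gx0.
have x0V : x0 \in interior_vertices by rewrite mem_interior.
pose A := [pred x : interior_vertices | g (val x)].
have A0 : A [` x0V] by [].
case: (arg_minP (fun x : interior_vertices => depth k (val x)) A0) => x gx xmin.
rewrite /= in gx.
have xI : interior P (val x) by rewrite -mem_interior; apply: valP.
have [yI|yN] := boolP (interior P (val x + hexdir k)); last first.
  have : g (val x) = false by apply: g0; rewrite mem_rim yN xI.
  by rewrite gx.
have xE : val x = val x + hexdir k + hexdir (k + 3) by rewrite -hexdir_opp addrK.
have l6 : ((k + 3) %% 6 < 6)%N by rewrite ltn_mod.
have := winding_sum w yI; rewrite (bigD1 (Ordinal l6)) //= hexdir_mod -xE gx.
rewrite big1 // => -[l /= ll6]; rewrite -val_eqE /= => lk.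
apply: negbTE; apply/negP => gz.
have := @winding_neighbour _ _ _ l (val x + hexdir k) w ll6 _.
case=> [|zI|]; [by apply/interiorP| |by rewrite gz].
have zV : val x + hexdir k + hexdir l \in interior_vertices by rewrite mem_interior.
have := xmin [` zV] gz; rewrite leNgt /= => /negP[].
by rewrite [X in _ < depth _ X]xE; apply: depth_lt.
Qed.

(** The first segment of beam [i] cuts off one end of its pane. If that end is not [v], reflection
    carries the colour to the segment at [v] in the same cell. *)
Lemma boundary_colour (chi : colouring) i k v : beam_invariant chi -> (k < 6)%N ->
  bpane i = v + v + hexdir k ->
  (if hexcell k v \in S then corner_colour chi k v
   else corner_colour chi ((k + 5) %% 6)%N v) = chi i.
Proof.
move=> inv k6 pE; have b : boundary_pane S (v + v + hexdir k).
  by rewrite -pE bpane_boundary.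
have [E E'] := corner_colour_boundary inv k6 b.
have start l x : hexcell l x \in S -> (corner_segment l x).1 = v + v + hexdir k ->
    corner_colour chi l x = chi i.
  rewrite -hexcell_mod -corner_segment_mod /corner_colour => lS pl.
  rewrite -(corner_segment_mod l); apply: colour_start; last by rewrite pl.
  by apply: corner_segment_crosses; rewrite ?ltn_mod.
have := corner_segment_pane v k6; rewrite /=.
have kk : corner_colour chi ((k + 5) %% 6)%N v = corner_colour chi (k + 5) v.
  by rewrite /corner_colour corner_segment_mod.
have := boundary_hexcell S v k6; rewrite b kk.
case: (boolP (hexcell k v \in S)) => /= kS k5S.
- case: odd => -[p1 p2 p3 p4]; first by apply: start; rewrite ?p1.
  by rewrite E; apply: start; rewrite ?p1 ?hexcell_shift.
- case: odd => -[p1 p2 p3 p4]; first by apply: start; rewrite ?p2 -?k5S.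
  by rewrite E'; apply: start; rewrite ?p2 ?hexcell_shift' // -k5S.
Qed.

(** Successive boundary panes meet at a vertex [v]. As [g] vanishes at [v] and at the far ends of
    the panes inside the polygon at [v], corner colours agree across these panes, and [fan] links
    the two boundary panes. *)
Lemma winding_const (chi : colouring) g : beam_invariant chi -> winding chi g ->
  (forall x, interior P x -> g x = false) -> forall i j, chi i = chi j.
Proof.
move=> inv w g0; apply: ordS_const => i; pose v := bvertex (ordS i).
have [l [l6 _ lE]] := bvertex_next (ordS i).
have [k k6 kE] : exists2 k, (k < 6)%N & bpane i = v + v + hexdir k.
  have [k [k6 vE ->]] := bvertex_next i; exists ((k + 3) %% 6)%N; rewrite ?ltn_mod //.
  by rewrite hexdir_mod -hexdir_opp /v vE addrA addrK addrAC.
have kl : k != l.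
  apply/eqP => kl; have /bpane_inj ij : bpane i = bpane (ordS i) by rewrite kE lE kl.
  have := bvertex_adj i; rewrite -ij subrr; by [].
rewrite -(boundary_colour inv k6 kE) -(boundary_colour inv l6 lE) -/v.
apply/esym; pose m r := hexcell r v \in S; pose t r := corner_colour chi r v.
apply: (@fan m t k l) => // r r6; rewrite /m /t hexcell_mod.
(* The curve visits [v] only once, so the boundary panes at [v] are the one before it, with index
   [k], and the one after it, with index [l]. *)
- rewrite -boundary_hexcell //; apply/idP/orP => [/boundaryP[j rE]|]; last first.
    by case=> /eqP->; rewrite -?kE -?lE bpane_boundary.
  have [q [q6 qE _]] := bvertex_next j; rewrite qE -addrA in rE.
  have [vj|[vj _]] := unit_vectors_mid (hexdir_unit r) (hexdir_unit q) rE; [right|left].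
    move/bvertex_inj: vj => ij; have : v + v + hexdir r = v + v + hexdir l.
      by rewrite -lE ij /bpane qE -rE addrA.
    by move/addrI/hexdir_inj => ->.
  move: vj; rewrite -qE => /bvertex_inj /ordS_inj ij.
  have : v + v + hexdir r = v + v + hexdir k.
    by rewrite -kE ij /bpane qE -rE addrA.
  by move/addrI/hexdir_inj => ->.
- move=> rS r5S; have := winding_inside w r6 rS r5S.
  rewrite w.2; have -> : g (v + hexdir r) = false.
    by case: (winding_neighbour w r6 rS) => // /g0.
  rewrite /corner_colour corner_segment_mod.
  by case: (colour _ _ _); case: (colour _ _ _).
Qed.

(** The dimension count is done with cardinalities: sets of orbits avoiding that of [i0] inject into
    subsets of the rim. Fixing the colour false at [i0] leaves only one of the two constant
    colourings. *)
Lemma leq_cyc_rim k : (k < 6)%N -> ((cyc P).-1 <= #|` rim k|)%N.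
Proof.
move=> k6; set s := billiards_perm P.
pose i0 : 'I_(perim P) := Ordinal (ltnW (ltnW (perim_gt2 P))).
pose chi (X : {set {set 'I_(perim P)}}) i := porbit s i \in X.
have inv X : beam_invariant (chi X).
  by move=> i; rewrite /chi -[s i]/((s ^+ 1)%g i) porbit_perm.
have [g gP] := choice (fun X => winding_exists (inv X)).
pose A := porbits s :\ porbit s i0.
have inj : {in powerset A &, injective (fun X => [set x : rim k | g X (val x)])}.
  move=> X Y; rewrite !inE => XA YA /setP gXY.
  have w := winding_add (gP X) (gP Y).
  have cst : forall i j, chi X i (+) chi Y i = chi X j (+) chi Y j.
    apply: (winding_const _ w) => [i|]; first by rewrite !inv.
    apply: (winding_rim k6 w) => x xr; have := gXY [` xr].
    by rewrite !inE /= => ->; rewrite addbb.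
  have sub0 (Z : {set {set 'I_(perim P)}}) : Z \subset A -> chi Z i0 = false.
    by move/subsetP => ZA; apply/negP => /ZA; rewrite !inE eqxx.
  have eqi i : chi X i = chi Y i.
    by have := cst i i0; rewrite !sub0 //; case: (chi X i); case: (chi Y i).
  apply/setP => O; have [/imsetP[i _ ->]|OA] := boolP (O \in porbits s).
    exact: eqi.
  by apply/idP/idP => [/(subsetP XA)|/(subsetP YA)]; rewrite !inE (negbTE OA) andbF.
have := leq_card_in _ _ inj; rewrite card_powerset.
rewrite -(cardsT {set rim k}) -powersetT card_powerset cardsT -cardfE leq_exp2l //.
suff -> : #|A| = (cyc P).-1 by [].
have i0P : porbit s i0 \in porbits s by apply: imset_f.
by rewrite /cyc -/s (cardsD1 (porbit s i0) (porbits s)) i0P.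
Qed.

Lemma hexcell_inj k : injective (hexcell k).
Proof.
move=> [a b] [c d]; rewrite -!(hexcell_mod k).
have := ltn_pmod k (isT : 0 < 6)%N; move: (k %% 6)%N => {}k.
by hexcases k => _; rewrite /hexcell /= ?pairN ?pairD => -[? ?]; congr pair; lia.
Qed.

Lemma hexcell_eq k l x y : (k < 6)%N -> (l < 6)%N -> hexcell k x = hexcell l y ->
  [\/ k = l /\ x = y, y = x + hexdir k | x = y + hexdir l].
Proof.
move=> k6 l6 E.
have [kl|kl] := eqVneq k l.
  by constructor 1; split=> //; apply: (@hexcell_inj k); rewrite E kl.
have [kl2|kl2] := eqVneq l ((k + 2) %% 6)%N.
  constructor 2; apply: (@hexcell_inj l).
  by rewrite -E [in RHS]kl2 hexcell_mod hexcell_shift.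
(* Equal cells point the same way, so [k] and [l] have the same parity, and only one difference
   modulo 6 is left. *)
have {kl2} lk2 : k = ((l + 2) %% 6)%N.
  have : (hexcell k x).2 = (hexcell l y).2 by rewrite E.
  by move: k6 l6 kl kl2 {E}; hexcases k => _; hexcases l.
constructor 3; apply: (@hexcell_inj k).
by rewrite E [in RHS]lk2 hexcell_mod hexcell_shift.
Qed.

Lemma sum_rim : (\sum_(0 <= k < 6) #|` rim k| <= area P)%N.
Proof.
pose s := [seq hexcell k x | k <- iota 0 6, x <- rim k].
have -> : (\sum_(0 <= k < 6) #|` rim k|)%N = size s.
  by rewrite size_allpairs_dep sumnE big_map.
apply: uniq_leq_size => [|_ /allpairsPdep[k [x [_ xk ->]]]]; last first.
  by move: xk; rewrite mem_rim => /andP[/interiorP].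
apply: allpairs_uniq_dep => [|k _|]; rewrite ?iota_uniq ?fset_uniq //.
move=> _ _ /allpairsPdep[k [x [k6 xk ->]]] /allpairsPdep[l [y [l6 yl ->]]] /=.
move: k6 l6 xk yl; rewrite !mem_iota !mem_rim => k6 l6 /andP[xI xN] /andP[yI yN] E.
(* If different pairs gave the same cell, one vertex would be the neighbour of the other in the
   latter's own direction, which is not interior by the definition of the rim. *)
case: (hexcell_eq k6 l6 E) => [[-> ->] //|yE|xE].
  by rewrite -yE yI in xN.
by rewrite -xE xI in yN.
Qed.

End Area.

Theorem theorem1p1 (P : grid_polygon) :
  (area P)%:Z >= 6 * (cyc P)%:Z - 6.
Proof.
have := sum_rim P; rewrite !big_nat_recr //= big_geq //.
have H := @leq_cyc_rim P.
move: (H 0%N isT) (H 1%N isT) (H 2%N isT) (H 3%N isT) (H 4%N isT) (H 5%N isT).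
move: (cyc P) (area P); do 6!move: #|` rim P _|%N; lia.
Qed.
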